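(* For every integer $m\ge 2$, the number of repeated palindrome occurrences in $F_m=\mathbb{F}[1,f_m]$ is $$B(f_m)=\frac{m-3}{5}f_{m+2}+\frac{m-1}{5}f_{m}+m+3.$$
   Context: The Fibonacci sequence $\mathbb{F}$ is the infinite word over $\{a,b\}$ that begins with $a$ and is fixed by the morphism $\sigma$ with $\sigma(a)=ab$, $\sigma(b)=a$. Letters are indexed from $1$; $\mathbb{F}[i,j]$ is the factor from the $i$-th to the $j$-th letter. The word $F_m=\sigma^m(a)$ is a prefix of $\mathbb{F}$ of length $f_m$, where $f_{-1}=f_0=1$ and $f_{k+1}=f_k+f_{k-1}$ for $k\ge 0$ (so $f_1=2$, $f_2=3$, $f_3=5$). A palindrome is a nonempty finite word equal to its reversal. For $n\ge 1$, $A(n)$ is the number of palindrome occurrences ending at position $n$, i.e. the number of $i\in\{1,\dots,n\}$ such that $\mathbb{F}[i,n]$ is a palindrome, and $B(n)=\sum_{i=1}^n A(i)$ is the number of repeated palindrome occurrences in $\mathbb{F}[1,n]$ (the number of pairs $1\le i\le j\le n$ with $\mathbb{F}[i,j]$ a palindrome). *)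

(* Defs.v *)
From HB Require Import structures.
From mathcomp Require Import all_boot.

Set Implicit Arguments.
Unset Strict Implicit.
Unset Printing Implicit Defensive.

Inductive letter := a | b.

Definition letter_is_a (x : letter) : bool := if x is a then true else false.
Definition letter_of_bool (t : bool) : letter := if t then a else b.
Lemma letter_is_aK : cancel letter_is_a letter_of_bool.
Proof. by case. Qed.
HB.instance Definition _ := Equality.copy letter (can_type letter_is_aK).

Definition sigma1 (x : letter) : seq letter :=
  match x with a => [:: a; b] | b => [:: a] end.

Definition sigma (u : seq letter) : seq letter := flatten (map sigma1 u).

(* An infinite word is a function w : nat -> letter whose k-th letter is w k
   for k >= 1; the value w 0 plays no role.  The word factor w i j is empty
   when j < i. *)
Definition factor (w : nat -> letter) (i j : nat) : seq letter :=
  [seq w k | k <- index_iota i j.+1].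

(* sigma w = w as infinite words: since sigma is non-erasing, this says that
   the image of each prefix of w is again a prefix of w. *)
Definition fixed_by_sigma (w : nat -> letter) : Prop :=
  forall n, let u := sigma (factor w 1 n) in u = factor w 1 (size u).

Definition is_fibonacci_word (w : nat -> letter) : Prop :=
  w 1 = a /\ fixed_by_sigma w.

Definition F (m : nat) : seq letter := iter m sigma [:: a].

(* f 1 = f 0 + f (-1) with f (-1) = 1; the index -1 is not needed otherwise. *)
Fixpoint f (m : nat) : nat :=
  match m with
  | 0 => 1
  | k.+1 => match k with 0 => 2 | j.+1 => f k + f j end
  end.

Definition palindrome (u : seq letter) : bool := (u != [::]) && (rev u == u).

Definition A (w : nat -> letter) (n : nat) : nat :=
  count (fun i => palindrome (factor w i n)) (index_iota 1 n.+1).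

Definition B (w : nat -> letter) (n : nat) : nat :=
  \sum_(1 <= i < n.+1) A w i.

Lemma sigma_cat u v : sigma (u ++ v) = sigma u ++ sigma v.
Proof. by rewrite /sigma map_cat flatten_cat. Qed.

Lemma F_rec m : F m.+2 = F m.+1 ++ F m.
Proof.
elim: m => [//|m IH].
have FS k : F k.+1 = sigma (F k) by [].
by rewrite (FS m.+2) IH sigma_cat -!FS -IH.
Qed.

Lemma size_F m : size (F m) = f m.
Proof.
suff: size (F m) = f m /\ size (F m.+1) = f m.+1 by case.
by elim: m => [//|m [IH0 IH1]]; split=> //; rewrite F_rec size_cat IH0 IH1.
Qed.

Lemma prefix_F m n : m <= n -> prefix (F m) (F n).
Proof.
elim: n => [|n IH]; first by rewrite leqn0 => /eqP ->; apply: prefix_refl.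
rewrite leq_eqVlt => /predU1P[->|]; first exact: prefix_refl.
move=> /IH /prefix_trans; apply; case: n {IH} => [//|n].
by rewrite F_rec prefix_prefix.
Qed.

Lemma ltn_f m : m < f m.
Proof.
suff: m < f m /\ m.+1 < f m.+1 by case.
elim: m => [//|m [IH0 IH1]]; split=> //.
have -> : f m.+2 = f m.+1 + f m by [].
by rewrite -[m.+3]addn1 leq_add // (leq_ltn_trans _ IH0).
Qed.

Lemma fibonacci_word_exists : exists w, is_fibonacci_word w.
Proof.
pose w k := nth a (F k) k.-1.
have wE m k : k < f m -> w k.+1 = nth a (F m) k.
  move=> km; rewrite /w succnK; case: (leqP k.+1 m) => h.
    have /prefixP[s ->] := prefix_F h.
    by rewrite nth_cat size_F (ltn_trans (ltnSn k)) ?ltn_f.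
  by have /prefixP[s ->] := prefix_F (ltnW h); rewrite nth_cat size_F km.
have fE m n : n <= f m -> factor w 1 n = take n (F m).
  move=> nm; apply: (@eq_from_nth _ a).
    by rewrite size_map size_iota subn1 size_takel ?size_F.
  move=> i; rewrite size_map size_iota subn1 => /= lin.
  rewrite (nth_map 0) ?size_iota ?subn1 // nth_iota ?subn1 // add1n nth_take //.
  by apply: wE; apply: leq_trans nm.
exists w; split=> // n u.
have nf : n <= f n by apply: ltnW; apply: ltn_f.
have Eu : F n.+1 = u ++ sigma (drop n (F n)).
  by rewrite /u (fE n) // -sigma_cat cat_take_drop.
rewrite (fE n.+1) ?Eu ?take_size_cat //.
by rewrite -size_F Eu size_cat leq_addr.
Qed.

(* Main.v *)
Require Import Defs.
From mathcomp Require Import all_boot all_order all_algebra.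
From mathcomp Require Import zify lra.
Import GRing.Theory.
Local Open Scope ring_scope.

(** The proof desubstitutes palindromes.  Reversal almost commutes with sigma:
    rev (sigma u ++ [:: a]) = sigma (rev u) ++ [:: a], so sigma u ++ [:: a] is
    a palindrome exactly when u is one or is empty.  In a word sigma v every b
    follows the a of the same block, so a palindromic factor of sigma v that
    begins and ends with a has the form sigma u ++ [:: a] for a palindromic or
    empty factor u of v, while one that begins and ends with b is sigma u
    without its first letter, for a palindromic factor u of v that begins and
    ends with a.

    Write S v for the number of palindromic suffixes of v, P v for the number
    of palindrome occurrences in v, and Pa v for the number of those that end
    with a.  An occurrence of u in v yields an occurrence of sigma u ++ [:: a]
    in sigma v unless u is a suffix of v, and the empty word occurs in v before
    each of its |v| letters, so
    - Pa (sigma v) = |v| + P v - S v    ([occ_a_sigma]),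
    - P (sigma v) = Pa (sigma v) + Pa v    ([occ_sigma]).

    For v = F m the same correspondence gives S (F m) = m./2 + 1
    ([pal_suffixes_F]).  Eliminating Pa yields
    P (F m.+2) = P (F m.+1) + P (F m) + f m.+2 - (m + 2),
    whose solution is the announced closed form. *)

Local Open Scope nat_scope.

(** * Palindromic suffixes and palindrome occurrences in a finite word *)

Fixpoint pal_suffixes (u : seq letter) : nat :=
  if u is _ :: v then palindrome u + pal_suffixes v else 0.

(** An occurrence is recorded by the position of its last letter, and p selects
    the occurrences by that letter: predT counts them all, pred1 a those that
    end with a. *)
Definition occ (p : pred letter) (u : seq letter) : nat :=
  \sum_(0 <= k < size u | p (nth a u k)) pal_suffixes (take k.+1 u).

Lemma occ_rcons p u x :
  occ p (rcons u x) = occ p u + p x * pal_suffixes (rcons u x).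
Proof.
rewrite /occ size_rcons big_mkcond big_nat_recr //= [in RHS]big_mkcond.
rewrite nth_rcons ltnn eqxx take_oversize ?size_rcons //.
congr (_ + _); last by case: (p x); rewrite ?mul1n.
apply: eq_big_nat => k /andP[_ ku].
by rewrite nth_rcons ku -cats1 takel_cat.
Qed.

Lemma palindrome_cons x u : palindrome (x :: u) = (rev (x :: u) == x :: u).
Proof. by []. Qed.

Lemma palindrome_ends x u y :
  palindrome (x :: rcons u y) = (x == y) && (rev u == u).
Proof.
rewrite palindrome_cons rev_cons rev_rcons rcons_cons eqseq_cons eqseq_rcons.
by rewrite [y == x]eq_sym; case: (x == y); rewrite ?andbT ?andbF.
Qed.

(** * Palindromes in sigma-images *)

Lemma sigma_rcons u x : sigma (rcons u x) = sigma u ++ sigma1 x.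
Proof. by rewrite -cats1 sigma_cat /sigma /= cats0. Qed.

Lemma sigma_rcons_a u : sigma (rcons u a) = rcons (rcons (sigma u) a) b.
Proof. by rewrite sigma_rcons -!cats1 -catA. Qed.

Lemma sigma_rcons_b u : sigma (rcons u b) = rcons (sigma u) a.
Proof. by rewrite sigma_rcons cats1. Qed.

(** Decoding proceeds from the left: the letter after the a that opens a block
    tells sigma1 a from sigma1 b, and the appended a provides this letter for
    the last block as well. *)
Lemma sigma_a_inj : injective (fun u => rcons (sigma u) a).
Proof.
elim=> [|x u IH] [|y v] //.
- by case: y => // -[]; case: v => [|[]].
- by case: x => // -[]; case: u {IH} => [|[]].
case: x; case: y => //= -[].
- by move=> /IH ->.
- by case: v => [|[]].
- by case: u {IH} => [|[]].
- by move=> /IH ->.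
Qed.

Lemma rev_sigma_a u : rev (rcons (sigma u) a) = rcons (sigma (rev u)) a.
Proof.
elim: u => [//|x u IH]; rewrite rev_cons sigma_rcons.
have -> : sigma (x :: u) = sigma1 x ++ sigma u by [].
by rewrite rcons_cat rev_cat IH -!cats1 -!catA; case: x.
Qed.

Lemma rev_sigma_a_eq u :
  (rev (rcons (sigma u) a) == rcons (sigma u) a) = (rev u == u).
Proof. by rewrite rev_sigma_a (inj_eq sigma_a_inj). Qed.

(** A palindromic suffix of sigma v ++ [:: a] begins with a, so what precedes
    its last letter is the sigma-image of a suffix of v; the extra one on the
    right is that last letter alone, which comes from the empty suffix. *)
Lemma pal_suffixes_sigma_a v :
  pal_suffixes (rcons (sigma v) a) = (pal_suffixes v).+1.
Proof.
elim: v => [//|x v IH].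
have sE : palindrome (rcons (sigma (x :: v)) a) = palindrome (x :: v).
  by rewrite palindrome_cons -rev_sigma_a_eq; case: x.
rewrite [pal_suffixes (x :: v)]/= -sE; case: x {sE}.
  have -> : sigma (a :: v) = [:: a, b & sigma v] by [].
  by rewrite !rcons_cons [LHS]/= palindrome_ends IH add0n addnS.
have -> : sigma (b :: v) = a :: sigma v by [].
by rewrite !rcons_cons [LHS]/= IH addnS.
Qed.

(** Here a palindromic suffix ends with b, so it begins with the b of a block
    ab; restoring the a of that block identifies it with the sigma-image of a
    palindromic suffix of v ++ [:: a] that begins with a. *)
Lemma pal_suffixes_sigma_rcons_a v :
  pal_suffixes (sigma (rcons v a)) = pal_suffixes (rcons v a).
Proof.
elim: v => [//|x v IH]; rewrite rcons_cons [RHS]/= palindrome_ends -IH.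
case: x.
  have -> : sigma (a :: rcons v a) = [:: a, b & sigma (rcons v a)] by [].
  rewrite sigma_rcons_a [LHS]/=.
  by rewrite -rcons_cons !palindrome_ends rev_sigma_a_eq.
have -> : sigma (b :: rcons v a) = a :: sigma (rcons v a) by [].
by rewrite sigma_rcons_a [LHS]/= palindrome_ends.
Qed.

(** Each letter of v contributes one position with letter a to sigma v, namely
    the start of its block; the palindromes ending there are counted by
    [pal_suffixes_sigma_a], applied to the prefix of v before that letter.  The
    suffixes of v itself are thus left out. *)
Lemma occ_a_sigma v :
  occ (pred1 a) (sigma v) + pal_suffixes v = size v + occ predT v.
Proof.
elim/last_ind: v => [|v x /= IH]; first by rewrite /occ !big_nil.
rewrite size_rcons occ_rcons /= mul1n; case: x.
  by rewrite sigma_rcons_a !occ_rcons /= pal_suffixes_sigma_a; lia.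
by rewrite sigma_rcons_b occ_rcons /= pal_suffixes_sigma_a; lia.
Qed.

Lemma occ_sigma v :
  occ predT (sigma v) = occ (pred1 a) (sigma v) + occ (pred1 a) v.
Proof.
elim/last_ind: v => [|v x /= IH]; first by rewrite /occ !big_nil.
case: x.
  rewrite sigma_rcons_a !occ_rcons /= -sigma_rcons_a pal_suffixes_sigma_rcons_a.
  by rewrite IH; lia.
by rewrite sigma_rcons_b !occ_rcons /= IH; lia.
Qed.

(** * The words F m *)

(** For even m the word F m ends with a, and its palindromic suffixes are
    governed by those of F m without that letter; the induction has to follow
    both. *)
Lemma F_double k : exists G,
  [/\ F k.*2 = rcons G a, pal_suffixes G = k &
      pal_suffixes (rcons G a) = k.+1].
Proof.
elim: k => [|k [G [FG SG _]]]; first by exists [::].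
exists (sigma (rcons (sigma G) a)); split.
- have -> : F k.+1.*2 = sigma (sigma (F k.*2)) by [].
  by rewrite FG sigma_rcons_a sigma_rcons_b.
- by rewrite pal_suffixes_sigma_rcons_a pal_suffixes_sigma_a SG.
- by rewrite !pal_suffixes_sigma_a SG.
Qed.

Lemma pal_suffixes_F m : pal_suffixes (F m) = m./2.+1.
Proof.
have [G [FG _ SGa]] := F_double m./2.
rewrite -[in LHS](odd_double_half m); case: (odd m); last by rewrite FG.
have -> : F (true + m./2.*2) = sigma (F m./2.*2) by [].
by rewrite FG pal_suffixes_sigma_rcons_a.
Qed.

Lemma occ_F_rec m :
  occ predT (F m.+2) + m.+2 = occ predT (F m.+1) + occ predT (F m) + f m.+2.
Proof.
have occE := occ_sigma (F m.+1).
have := occ_a_sigma (F m.+1); have := occ_a_sigma (F m).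
rewrite !pal_suffixes_F !size_F.
have -> : f m.+2 = f m.+1 + f m by [].
have -> : F m.+2 = sigma (F m.+1) by [].
rewrite {}occE; have -> : F m.+1 = sigma (F m) by [].
by lia.
Qed.

(** The closed form cleared of denominators and subtractions. *)
Lemma occ_F m :
  5 * occ predT (F m) + 3 * f m.+2 + f m = m * f m.+2 + m * f m + 5 * m + 15.
Proof.
have fE k : f k.+2 = f k.+1 + f k by [].
pose Q k := 5 * occ predT (F k) + 3 * f k.+2 + f k =
            k * f k.+2 + k * f k + 5 * k + 15.
suff: Q m /\ Q m.+1 by case.
elim: m => [|m [IH0 IH1]]; first by rewrite /Q /occ !unlock.
split=> //; have := occ_F_rec m; move: IH0 IH1; rewrite /Q !fE; nia.
Qed.

(** * Prefixes of the Fibonacci word *)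

Lemma factor_F w m : is_fibonacci_word w -> factor w 1 (f m) = F m.
Proof.
case=> w1 wfix; elim: m => [|m IH]; first by rewrite /factor /= w1.
have := wfix (f m); rewrite IH -/(F m.+1) => Fm.
by rewrite -size_F; apply: esym.
Qed.

Lemma factor_rcons w i n : i <= n.+1 ->
  factor w i n.+1 = rcons (factor w i n) (w n.+1).
Proof.
move=> le_in; rewrite /factor /index_iota subSn // -addn1 iotaD map_cat cats1.
by rewrite subnKC.
Qed.

Lemma pal_suffixes_factor w n : pal_suffixes (factor w 1 n) = A w n.
Proof.
rewrite /A /factor /index_iota !subn1 /=.
suff H k i : pal_suffixes [seq w j | j <- iota i k] =
    count (fun j => palindrome [seq w l | l <- iota j (i + k - j)]) (iota i k).
  by rewrite H; apply: eq_count.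
elim: k i => [//|k IH] i; rewrite [iota i k.+1]/= map_cons [LHS]/= IH /=.
by rewrite [i + k.+1 - i]addKn addSnnS.
Qed.

Lemma occ_factor w n : occ predT (factor w 1 n) = B w n.
Proof.
elim: n => [|n IH]; first by rewrite /occ /B !big_geq.
by rewrite /B big_nat_recr //= -/(B w n) -IH factor_rcons // occ_rcons mul1n
           -factor_rcons // pal_suffixes_factor.
Qed.

Local Open Scope ring_scope.

Theorem theorem6p7 (w : nat -> letter) (hw : is_fibonacci_word w)
    (m : nat) (hm : (2 <= m)%N) :
  F m = factor w 1 (f m) /\
  (B w (f m))%:R =
    (m%:R - 3%:R) / 5%:R * (f (m + 2))%:R + (m%:R - 1) / 5%:R * (f m)%:R
    + m%:R + 3%:R :> rat.
Proof.
split; first by rewrite factor_F.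
have := occ_F m; rewrite -occ_factor factor_F // addn2.
move: (occ _ _) (f m) (f m.+2) => P x y /(congr1 (fun k => k%:R : rat)).
rewrite !(natrM, natrD) => E.
lra.
Qed.
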